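(* Let $R$ be a connected graph on $r$ vertices, $B_k$ a generalized Bethe tree on $k\ge 2$ levels, $\alpha\in[0,1)$, and let $\rho_1(\alpha),\dots,\rho_r(\alpha)$ be the eigenvalues of $A_\alpha(R)$ with $\rho_1(\alpha)$ its spectral radius. Then: (1) $\mathrm{Spec}(A_\alpha(R\{B_k\}))=\big(\bigcup_{j=1}^{k-1}\mathrm{Spec}(T_j)\big)\cup\big(\bigcup_{i=1}^r\mathrm{Spec}(S_i)\big)$; (2) more precisely, for $1\le j\le k-1$ each eigenvalue of $T_j$ occurs as an eigenvalue of $A_\alpha(R\{B_k\})$ with multiplicity $r(n_j-n_{j+1})$ (contributed by $T_j$), and for $1\le i\le r$ each eigenvalue of $S_i$ contributes multiplicity one; if eigenvalues coming from different matrices coincide, the multiplicities add; (3) the largest eigenvalue of $S_1$ is the spectral radius of $A_\alpha(R\{B_k\})$.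
   Context: $A_\alpha(G)=\alpha D(G)+(1-\alpha)A(G)$ ($D$ degree matrix, $A$ adjacency matrix); $\beta=1-\alpha$. $R\{H\}$ is obtained from $R$ (vertices $v_1,\dots,v_r$) and $r$ copies of the rooted graph $H$ by identifying the root of the $i$-th copy with $v_i$. A generalized Bethe tree is a rooted tree in which all vertices at the same level have the same degree (root at level 1, level = distance to root plus one); $B_k$ has $k$ levels. For $1\le j\le k$, $n_j$ and $d_j$ are the number and common degree of the vertices of $B_k$ at level $k-j+1$ (so $n_k=1$, $d_1=1$, $d_k$ is the root degree). $T_k$ is the $k\times k$ symmetric tridiagonal matrix with diagonal $(\alpha,\alpha d_2,\dots,\alpha d_{k-1},\alpha d_k)$ and off-diagonal entries in positions $(j,j+1),(j+1,j)$ equal to $\beta\sqrt{d_{j+1}-1}$ for $1\le j\le k-2$ and $\beta\sqrt{d_k}$ for $j=k-1$; for $1\le j\le k-1$, $T_j$ is the $j\times j$ leading principal submatrix of $T_k$. For $1\le i\le r$, $S_i$ is $T_k$ with its $(k,k)$ entry replaced by $\alpha d_k+\rho_i(\alpha)$. Spectra are multisets.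
   Formalization: Clause (1) is stated only with the multiplicities of (2): as a plain union it fails when n_j = n_{j+1}, since T_j then contributes multiplicity 0 (e.g. R one vertex, B_2 = K_2: α is in Spec(T_1) but is not an eigenvalue). *)

(* Defs.v *)
From HB Require Import structures.
From mathcomp Require Import all_boot all_order all_algebra.
Set Implicit Arguments. Unset Strict Implicit. Unset Printing Implicit Defensive.
Import Order.TTheory GRing.Theory Num.Theory.
Local Open Scope ring_scope.

Definition simple_graph (T : finType) (e : rel T) :=
  symmetric e /\ irreflexive e.

Definition connected_graph (T : finType) (e : rel T) :=
  forall x y : T, connect e x y.

Definition deg (T : finType) (e : rel T) (x : T) : nat := #|[set y | e x y]|.

Definition nedges (T : finType) (e : rel T) : nat :=
  (#|[set p : T * T | e p.1 p.2]| %/ 2)%N.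

Definition is_tree (T : finType) (e : rel T) :=
  simple_graph e /\ connected_graph e /\ nedges e = (#|T| - 1)%N.

Definition dist (T : finType) (e : rel T) (v0 x : T) : nat :=
  find (fun n => [exists p : n.-tuple T, path e v0 p && (last v0 p == x)])
       (iota 0 #|T|).

Definition level (T : finType) (e : rel T) (v0 x : T) : nat := (dist e v0 x).+1.

Definition gen_Bethe_tree (T : finType) (e : rel T) (v0 : T) (k : nat) :=
  [/\ is_tree e,
      (forall x, level e v0 x <= k)%N,
      (exists x, level e v0 x = k) &
      (forall x y, level e v0 x = level e v0 y -> deg e x = deg e y)].

(* n_j : number of vertices at level k-j+1;  d_j : their common degree *)
Definition Bn (T : finType) (e : rel T) (v0 : T) (k j : nat) : nat :=
  #|[set x | level e v0 x == (k - j).+1]|.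
Definition Bd (T : finType) (e : rel T) (v0 : T) (k j : nat) : nat :=
  if [pick x | level e v0 x == (k - j).+1] is Some x then deg e x else 0%N.

(* R{H}: r copies of the rooted graph H, the root of the i-th copy glued to v_i *)
Definition rooted_prod (r : nat) (eR : rel 'I_r) (T : finType) (eH : rel T)
  (v0 : T) : rel ('I_r * T) :=
  fun u v => ((u.1 == v.1) && eH u.2 v.2)
          || [&& u.2 == v0, v.2 == v0 & eR u.1 v.1].

Definition Aalpha (R : nzRingType) (T : finType) (e : rel T) (alpha : R)
  : 'M[R]_#|T| :=
  \matrix_(i, j) ((if i == j then alpha * (deg e (enum_val i))%:R else 0)
                  + (1 - alpha) * (e (enum_val i) (enum_val j))%:R).

(* entry (a,b) (0-based) of T_k, built from the degrees d_1..d_k *)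
Definition Tentry (R : rcfType) (alpha : R) (d : nat -> nat) (k a b : nat) : R :=
  let beta := 1 - alpha in
  if a == b then (if a == 0%N then alpha else alpha * (d a.+1)%:R)
  else if (b == a.+1) || (a == b.+1) then
    let m := minn a b in
    (if m.+1 == k.-1 then beta * Num.sqrt (d k)%:R
     else beta * Num.sqrt ((d m.+2)%:R - 1))
  else 0.

Definition Tmat (R : rcfType) (alpha : R) (d : nat -> nat) (k j : nat) : 'M[R]_j :=
  \matrix_(a < j, b < j) Tentry alpha d k a b.

Definition Smat (R : rcfType) (alpha : R) (d : nat -> nat) (k : nat) (rho : R)
  : 'M[R]_k :=
  \matrix_(a < k, b < k)
    (Tentry alpha d k a b + (if (a == k.-1 :> nat) && (b == k.-1 :> nat) then rho else 0)).

Definition eig_mult (R : fieldType) (n : nat) (A : 'M[R]_n) (x : R) : nat :=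
  mup x (char_poly A).

Definition is_spectral_radius (R : numFieldType) (n : nat) (A : 'M[R]_n) (s : R) :=
  (exists mu, eigenvalue A mu /\ `|mu| = s) /\
  (forall mu, eigenvalue A mu -> `|mu| <= s).

Definition is_largest_eigenvalue (R : numFieldType) (n : nat) (A : 'M[R]_n) (s : R) :=
  eigenvalue A s /\ (forall mu, eigenvalue A mu -> mu <= s).

(* Main.v *)
Require Import Defs.
From HB Require Import structures.
From mathcomp Require Import all_boot all_order all_algebra.
From mathcomp Require Import fingroup perm complex ring zify.
Import Order.TTheory GRing.Theory Num.Theory.
Local Open Scope ring_scope.
Set Implicit Arguments. Unset Strict Implicit. Unset Printing Implicit Defensive.

(** Eliminating the vertices of the copies of the tree from the leaves towards
    the roots creates no fill-in: [x I - A = L D L^T] with [L] unitriangular, the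
    pivot of a vertex depending only on its level, and the block of [D] on the
    roots being [p I - A_alpha(R)] with [p] the root pivot. The same elimination
    on a path shows that these pivots are those of [x I - T_k] (and of
    [x I - S_i], up to the last one), so that [det (x I - A)] is the announced
    product for all [x] outside a finite set, hence as a polynomial.

    For the spectral radius, the spectral theorem over [R[i]] bounds the Rayleigh
    quotients of a real symmetric matrix by its largest eigenvalue. Each [T_j] is
    a compression of [S_1] and [S_i <= S_1] as quadratic forms, so the largest
    eigenvalue of [S_1] is the largest one of [A]; as the entries of [A] are
    nonnegative, replacing an eigenvector by its absolute value shows that it also
    bounds the moduli of the eigenvalues. *)

(** * Determinants along a forest *)

(** A permutation that strictly raises [lev] at every point it moves would change the sum of [lev],
    so only the identity contributes. *)
Lemma det_ranked {F : comNzRingType} {n} (A : 'M[F]_n) (lev : 'I_n -> nat) :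
  (forall i j, i != j -> (lev j <= lev i)%N -> A i j = 0) ->
  \det A = \prod_i A i i.
Proof.
move=> A0; rewrite /determinant (bigD1 1%g) //= odd_perm1 expr0 mul1r.
under eq_bigr do rewrite perm1.
rewrite [X in _ + X]big1 ?addr0 // => s sN1.
have [i /andP[iNs lei]] : exists i, (i != s i) && (lev (s i) <= lev i)%N.
  apply/existsP; apply: contraR sN1; rewrite negb_exists => /forallP sP.
  have leS i : (lev i <= lev (s i))%N.
    by have := sP i; case: (altP (i =P s i)) => [<-//|_] /=; rewrite -ltnNge => /ltnW.
  have eqS : (\sum_i lev i = \sum_i lev (s i))%N by rewrite (reindex_inj (@perm_inj _ s)).
  apply/eqP/permP => i; rewrite perm1; apply/esym/eqP; have := sP i.
  case: (altP (i =P s i)) => //= _; rewrite -ltnNge => lti.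
  have := eqS; rewrite (bigD1 i) //= [in RHS](bigD1 i) //= => eqS'.
  have le2 : (\sum_(j | j != i) lev j <= \sum_(j | j != i) lev (s j))%N by exact: leq_sum.
  by have := leq_add lti le2; rewrite addSn eqS' ltnn.
by rewrite (bigD1 i) //= A0 // mul0r mulr0.
Qed.

(* Gaussian elimination from the leaves to the roots of a forest creates no
   fill-in: the matrix factors as [L D L^T], with column [v] of [L] equal to
   [e_v - (w v / f v) e_(par v)]. *)
Lemma det_forest {F : fieldType} {n} {V : finType} (h : 'I_n -> V) (rt : pred V)
    (par : V -> V) (lev : V -> nat) (w f : V -> F) (D M : V -> V -> F) :
  bijective h ->
  (forall v, ~~ rt v -> (lev (par v) < lev v)%N) ->
  (forall v, ~~ rt v -> f v != 0) ->
  (forall u v, ~~ (rt u && rt v) -> D u v = if u == v then f u else 0) ->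
  (forall u v, M u v = D u v - (if ~~ rt u && (par u == v) then w u else 0)
     - (if ~~ rt v && (par v == u) then w v else 0)
     + (if u == v then \sum_(c | ~~ rt c && (par c == u)) w c ^+ 2 / f c else 0)) ->
  \det (\matrix_(i, j) M (h i) (h j)) = \det (\matrix_(i, j) D (h i) (h j)).
Proof.
move=> bijh levP fN0 DE ME.
pose l u v : F := (if u == v then 1 else 0)
                - (if ~~ rt v && (par v == u) then w v / f v else 0).
pose L : 'M[F]_n := \matrix_(i, j) l (h i) (h j).
pose DD : 'M[F]_n := \matrix_(i, j) D (h i) (h j).
have sumE (g : V -> F) : \sum_i g (h i) = \sum_v g v.
  by rewrite (reindex h) //; apply: onW_bij.
have DEn c v : ~~ rt c -> D c v = if c == v then f c else 0.
  by move=> rc; apply: DE; rewrite (negbTE rc).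
have lsum (g : V -> F) u : \sum_c l u c * g c
    = g u - \sum_(c | ~~ rt c && (par c == u)) w c / f c * g c.
  rewrite [in RHS]big_mkcond /= (bigD1 u) //= [in RHS](bigD1 u) //= /l eqxx.
  rewrite mulrBl mul1r opprD addrA; congr (_ + _).
    by congr (_ - _); case: ifP => _; rewrite ?mul0r.
  rewrite -sumrN; apply: eq_bigr => c cu; rewrite eq_sym (negbTE cu) sub0r mulNr.
  by case: ifP => _; rewrite ?mul0r.
have LDE u v : \sum_c l u c * D c v
    = D u v - (if ~~ rt v && (par v == u) then w v else 0).
  rewrite lsum; congr (_ - _).
  transitivity (\sum_(c | ~~ rt c && (par c == u)) if c == v then w v else 0).
    apply: eq_bigr => c /andP[rc _]; rewrite DEn //.
    by case: (c =P v) rc => [->|_] rv; rewrite ?mulr0 // mulfVK // fN0.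
  by rewrite -big_mkcondr /= big_mkcond (bigD1 v) //= eqxx andbT big1 ?addr0 //
     => c /negbTE ->; rewrite andbF.
have E : \matrix_(i, j) M (h i) (h j) = L *m DD *m L^T.
  apply/matrixP => i j; rewrite !mxE.
  transitivity (\sum_c l (h j) c * (\sum_b l (h i) b * D b c)); last first.
    rewrite -sumE; apply: eq_bigr => a _; rewrite !mxE mulrC; congr (_ * _).
    by rewrite -sumE; apply: eq_bigr => b _; rewrite !mxE.
  move: (h i) (h j) => u v; rewrite lsum LDE ME.
  (* Among the children [c] of [v], the term [D u c] survives only for [c = u], and the term [w c]
     of [LDE] only for children of [u], which forces [u = v]. *)
  have -> : \sum_(c | ~~ rt c && (par c == v)) w c / f c * (\sum_b l u b * D b c)
     = (if ~~ rt u && (par u == v) then w u else 0)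
       - (if u == v then \sum_(c | ~~ rt c && (par c == u)) w c ^+ 2 / f c else 0).
    transitivity (\sum_(c | ~~ rt c && (par c == v))
       ((if c == u then w u else 0) - (if par c == u then w c ^+ 2 / f c else 0))).
      apply: eq_bigr => c /andP[rc _]; rewrite LDE rc /= DE; last by rewrite (negbTE rc) andbF.
      rewrite mulrBr; congr (_ - _).
        by rewrite eq_sym; case: (c =P u) rc => [->|_] ru; rewrite ?mulr0 // mulfVK // fN0.
      by case: ifP => _; rewrite ?mulr0 // expr2 mulrAC.
    rewrite sumrB; congr (_ - _).
      by rewrite -big_mkcondr /= big_mkcond (bigD1 u) //= eqxx andbT big1 ?addr0 //
         => c /negbTE ->; rewrite andbF.
    case: (altP (u =P v)) => [->|uv]; first by apply: eq_bigr => c /andP[_ ->].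
    by rewrite big1 // => c /andP[_ /eqP ->]; rewrite eq_sym (negbTE uv).
  by ring.
have detL : \det L = 1.
  rewrite (@det_ranked _ _ _ (fun i => lev (h i))).
    apply: big1 => i _; rewrite mxE /l eqxx; case: ifP; rewrite ?subr0 //.
    by case/andP => /levP + /eqP e; rewrite e ltnn.
  move=> i j ij lji; rewrite mxE /l (inj_eq (bij_inj bijh)) (negbTE ij) sub0r.
  by case: ifP; rewrite ?oppr0 //; case/andP => /levP + /eqP e; rewrite e ltnNge lji.
by rewrite E !det_mulmx det_tr detL mul1r mulr1.
Qed.

(** Sylvester's identity: the block matrix with rows [(1, -X)] and [(Y, 1)] factors into block
    triangular matrices in two ways. *)
Lemma det1D_mulmxC {F : comNzRingType} {m n} (X : 'M[F]_(m, n)) (Y : 'M[F]_(n, m)) :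
  \det (1%:M + X *m Y) = \det (1%:M + Y *m X).
Proof.
have E1 : block_mx 1%:M (- X) Y 1%:M =
    block_mx 1%:M (- X) 0 1%:M *m block_mx (1%:M + X *m Y) 0 Y 1%:M.
  rewrite mulmx_block !(mul1mx, mul0mx, mulmx1, add0r, mulNmx).
  by rewrite addrK.
have E2 : block_mx 1%:M (- X) Y 1%:M =
    block_mx 1%:M 0 Y 1%:M *m block_mx 1%:M (- X) 0 (1%:M + Y *m X).
  rewrite mulmx_block !(mul1mx, mul0mx, mulmx1, addr0, mulmxN).
  by rewrite addrCA addNr addr0.
have := congr1 determinant E1; rewrite {1}E2 !det_mulmx !det_lblock !det_ublock !det1.
by rewrite !mul1r ?mulr1 => ->.
Qed.

(** [D] is a diagonal matrix times a perturbation of the identity supported on the roots, so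
    [det1D_mulmxC] shrinks the determinant to size [r] without reordering the indices. *)
Lemma det_root_block {F : comNzRingType} {n r} {T : finType} (h : 'I_n -> 'I_r * T)
    (v0 : T) (f : 'I_r * T -> F) (K : 'M[F]_r) (D : 'I_r * T -> 'I_r * T -> F) :
  bijective h ->
  (forall u v, D u v = if (u.2 == v0) && (v.2 == v0) then K u.1 v.1
                       else if u == v then f u else 0) ->
  \det (\matrix_(i, j) D (h i) (h j)) = \prod_(u | u.2 != v0) f u * \det K.
Proof.
move=> bijh DE; have hinj := bij_inj bijh.
have sumE (g : 'I_r * T -> F) : \sum_i g (h i) = \sum_v g v.
  by rewrite (reindex h) //; apply: onW_bij.
pose J : 'M[F]_(r, n) := \matrix_(i, a) if h a == (i, v0) then 1 else 0.
pose g : 'rV[F]_n := \row_a if (h a).2 == v0 then 1 else f (h a).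
have JJ : J *m J^T = 1%:M.
  apply/matrixP => i j; rewrite !mxE.
  transitivity (\sum_u ((if u == (i, v0) then 1 else 0) * (if u == (j, v0) then 1 else 0) : F)).
    by rewrite -sumE; apply: eq_bigr => a _; rewrite !mxE.
  rewrite (bigD1 (i, v0)) //= eqxx mul1r big1 ?addr0.
    by rewrite xpair_eqE eqxx andbT; case: eqP.
  by move=> u /negbTE ->; rewrite mul0r.
have JE (B : 'M[F]_r) : J^T *m (B *m J) =
    \matrix_(a, b) if ((h a).2 == v0) && ((h b).2 == v0) then B (h a).1 (h b).1 else 0.
  have JE1 p (C : 'M[F]_(r, p)) : J^T *m C =
      \matrix_(a, b) if (h a).2 == v0 then C (h a).1 b else 0.
    apply/matrixP => a b; rewrite !mxE (bigD1 (h a).1) //= !mxE big1 ?addr0.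
      by case: (h a) => x y /=; rewrite xpair_eqE eqxx; case: eqP; rewrite ?mul1r ?mul0r.
    move=> i; rewrite !mxE; case: (h a) => x y /= ix.
    by rewrite xpair_eqE eq_sym (negbTE ix) mul0r.
  rewrite -[J]trmxK -[B *m _]trmxK trmx_mul !trmxK !JE1; apply/matrixP => a b.
  by rewrite !mxE; do 2 case: ifP => //= _; rewrite !mxE.
have -> : \matrix_(i, j) D (h i) (h j) = diag_mx g *m (1%:M + J^T *m ((K - 1%:M) *m J)).
  rewrite JE; apply/matrixP => a b; rewrite mul_diag_mx !mxE DE (inj_eq hinj).
  case: (altP ((h a).2 =P v0)) => /= [ha|ha]; last by rewrite addr0; case: eqP;
    rewrite ?mulr1 ?mulr0.
  case: (altP ((h b).2 =P v0)) => /= [hb|hb].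
    have -> : (a == b) = ((h a).1 == (h b).1).
      rewrite -(inj_eq hinj); case: (h a) (h b) ha hb => x1 y1 [x2 y2] /= -> ->.
      by rewrite xpair_eqE eqxx andbT.
    by rewrite mul1r addrC subrK.
  rewrite addr0 mul1r; case: eqP => [e|//].
  by move: hb; rewrite -e ha eqxx.
rewrite det_mulmx det_diag det1D_mulmxC -mulmxA JJ mulmx1 addrC subrK; congr (_ * _).
rewrite [RHS]big_mkcond (reindex h) /=; last exact: onW_bij.
by apply: eq_bigr => a _; rewrite mxE; case: eqP.
Qed.

(** * Parents and levels in a generalized Bethe tree *)

Section Distance.
Context {T : finType} (e : rel T) (v0 : T).
Hypotheses (e_sym : symmetric e) (e_conn : connected_graph e).
Local Notation dist := (dist e v0).
Local Open Scope nat_scope.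

(** A duplicate-free path has fewer than [#|T|] edges, so the search in [dist] succeeds and does not
    fall through to the default of [find]. *)
Lemma distP x : exists p, [/\ path e v0 p, last v0 p = x & size p = dist x].
Proof.
pose P n := [exists p : n.-tuple T, path e v0 p && (last v0 p == x)].
have hP : has P (iota 0 #|T|).
  have /connectP[p pp] := e_conn v0 x.
  case/shortenP: pp => q pq /card_uniqP /= uq _ xq; apply/hasP; exists (size q).
    by rewrite mem_iota add0n -[(size q).+1]uq max_card.
  by apply/existsP; exists (in_tuple q); rewrite pq xq eqxx.
have := nth_find 0 hP; rewrite nth_iota -?[find _ _]/(dist x) ?add0n; last first.
  by rewrite -[X in _ < X](size_iota 0) -has_find.
by case/existsP => p /andP[pp /eqP lp]; exists p; rewrite size_tuple.
Qed.

Lemma dist_lt_card x : dist x < #|T|.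
Proof.
have [p [pp lp sp]] := distP x; rewrite ltnNge; apply/negP => le.
have /connectP[q qq qx] := e_conn v0 x.
case/shortenP: qq qx => q' pq /card_uniqP /= uq _ qx.
have lt : size q' < #|T| by rewrite -[(size q').+1]uq max_card.
have := before_find 0 (leq_trans lt le : size q' < dist x).
rewrite nth_iota // add0n => /negbT /existsP; apply.
by exists (in_tuple q'); rewrite pq qx eqxx.
Qed.

Lemma dist_le x p : path e v0 p -> last v0 p = x -> dist x <= size p.
Proof.
move=> pp lp; case: (ltnP (size p) #|T|) => [lt|le]; last first.
  exact: leq_trans (ltnW (dist_lt_card x)) le.
rewrite leqNgt; apply/negP => /(before_find 0).
rewrite nth_iota // add0n => /negbT /existsP; apply.
by exists (in_tuple p); rewrite pp lp eqxx.
Qed.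

Lemma dist0 : dist v0 = 0.
Proof. by apply/eqP; rewrite -leqn0 (@dist_le v0 [::]). Qed.

Lemma dist_eq0 x : (dist x == 0) = (x == v0).
Proof.
apply/eqP/eqP => [|->]; last exact: dist0.
by have [p [_ <- <-]] := distP x => /size0nil ->.
Qed.

Lemma dist_edge x y : e x y -> dist y <= (dist x).+1.
Proof.
have [p [pp lp <-]] := distP x => xy; rewrite -(size_rcons p y).
by apply: dist_le; rewrite ?last_rcons // rcons_path pp lp.
Qed.

(** At the root no [y] qualifies and the default makes it its own parent; hence the guards [x != v0]
    below. *)
Definition tree_parent x := odflt x [pick y | e x y && ((dist y).+1 == dist x)].

(** The last but one vertex of a shortest path to [x] qualifies. *)
Lemma tree_parentP x : x != v0 ->
  e x (tree_parent x) /\ (dist (tree_parent x)).+1 = dist x.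
Proof.
move=> xv; rewrite /tree_parent; case: pickP => [y /andP[xy /eqP yd] //|no].
have [p [+ lp sp]] := distP x; case/lastP: p lp sp => [|p z].
  by move=> /= vx; rewrite vx eqxx in xv.
rewrite last_rcons size_rcons rcons_path => -> sp /andP[pp ez].
have := no (last v0 p); rewrite e_sym ez /= eqn_leq -{1}sp ltnS dist_le //=.
by rewrite dist_edge.
Qed.
End Distance.

Section Tree.
Context {T : finType} (e : rel T) (v0 : T).
Hypothesis tree_e : is_tree e.
Local Notation dist := (dist e v0).
Local Notation par := (tree_parent e v0).
Local Open Scope nat_scope.

Let e_sym : symmetric e. Proof. by case: tree_e => [[]]. Qed.
Let e_irr : irreflexive e. Proof. by case: tree_e => [[]]. Qed.
Let e_conn : connected_graph e. Proof. by case: tree_e => [_ []]. Qed.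

Lemma dist_tree_parent x : x != v0 -> (dist (par x)).+1 = dist x.
Proof. by case/(tree_parentP e_sym e_conn). Qed.

(* The pairs [(x, par x)] and their reversals already account for [2 (#|T| - 1)]
   oriented edges, and a further edge would contribute two more. *)
Lemma tree_edgeE x y :
  e x y = ((x != v0) && (par x == y)) || ((y != v0) && (par y == x)).
Proof.
have parP := tree_parentP e_sym e_conn.
apply/idP/orP => [xy|[] /andP[/parP[+ _] /eqP <-] //]; last by rewrite e_sym.
apply/orP; apply: contraT; rewrite negb_or => /andP[n1 n2].
pose E := [set p : T * T | e p.1 p.2].
pose X := [set~ v0].
pose F1 := [set (z, par z) | z in X].
pose F2 := [set (par z, z) | z in X].
pose F3 := [set (x, y); (y, x)].
have cX : #|X| = #|T| - 1 by rewrite cardsC1 subn1.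
have c1 : #|F1| = #|T| - 1 by rewrite card_imset // => ? ? [].
have c2 : #|F2| = #|T| - 1 by rewrite card_imset // => ? ? [].
have c3 : #|F3| = 2.
  by rewrite cards2 xpair_eqE; case: eqP xy => [->|//]; rewrite e_irr.
have d12 : [disjoint F1 & F2].
  apply/pred0P => -[a b] /=; apply/negP => /andP[/imsetP[z + [-> ->]] /imsetP[t + [tz zt]]].
  rewrite !inE => /dist_tree_parent z1 /dist_tree_parent.
  by rewrite -tz -zt => t1; move: z1; rewrite -t1; lia.
have d3 : [disjoint F1 :|: F2 & F3].
  apply/pred0P => -[a b] /=; apply/negP; rewrite !inE.
  case/andP=> /orP[] /imsetP[z + [-> ->]];
    rewrite !inE !xpair_eqE => zv /orP[] /andP[/eqP zx /eqP zy];
    move: n1 n2; rewrite -?zx -?zy zv eqxx /= ?andbF //.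
have sub : F1 :|: F2 :|: F3 \subset E.
  apply/subsetP => -[a b]; rewrite !inE !xpair_eqE => /orP[/orP[]|/orP[]].
  - by case/imsetP=> z; rewrite !inE => /parP[? _] [-> ->].
  - by case/imsetP=> z; rewrite !inE => /parP[? _] [-> ->]; rewrite e_sym.
  - by case/andP => /eqP-> /eqP->.
  - by case/andP => /eqP-> /eqP->; rewrite e_sym.
have := subset_leq_card sub.
have := (leq_card_setU (F1 :|: F2) F3).2; rewrite d3 => /eqP ->.
have := (leq_card_setU F1 F2).2; rewrite d12 => /eqP ->.
(* [E] has at least [2 * (#|T| - 1) + 2] elements, so even after rounding its half exceeds the edge
   count of a tree. *)
rewrite c1 c2 c3; have [_ [_ <-]] := tree_e; rewrite /nedges -/E; lia.
Qed.

Definition nchildren x := #|[set y | (y != v0) && (par y == x)]|.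

Lemma deg_tree x : deg e x = (x != v0) + nchildren x.
Proof.
rewrite /deg /nchildren.
have -> : [set y | e x y] = [set y | (x != v0) && (par x == y)]
                       :|: [set y | (y != v0) && (par y == x)].
  by apply/setP => y; rewrite !inE tree_edgeE.
set P := [set y | _ && _]; set C := [set y | _ && _].
have PC : [disjoint P & C].
  apply/pred0P => y /=; apply/negP; rewrite !inE.
  case/andP => /andP[xv /eqP yx] /andP[yv /eqP xy].
  by have := dist_tree_parent xv; have := dist_tree_parent yv; rewrite yx xy; lia.
have := (leq_card_setU P C).2; rewrite PC => /eqP ->.
congr (_ + _); rewrite /P; case: (x != v0) => /=; last by apply: eq_card0 => y; rewrite !inE.
by rewrite -[RHS](cards1 (par x)); apply: eq_card => y; rewrite !inE eq_sym.
Qed.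
End Tree.

Section Bethe.
Context {T : finType} (e : rel T) (v0 : T) (k : nat).
Hypothesis bethe_e : gen_Bethe_tree e v0 k.
Local Notation dist := (dist e v0).
Local Notation par := (tree_parent e v0).
Local Open Scope nat_scope.

Let tree_e : is_tree e. Proof. by case: bethe_e. Qed.
Let e_conn : connected_graph e. Proof. by case: tree_e => [_ []]. Qed.

Lemma dist_lt_levels x : dist x < k.
Proof. by case: bethe_e => _ /(_ x). Qed.

(** Climb with [par] from a vertex of the deepest level. *)
Lemma exists_dist m : m < k -> exists x, dist x = m.
Proof.
move=> mk; have [_ _ [x0 x0k] _] := bethe_e.
have H i : i < k -> exists x, (dist x).+1 + i = k.
  elim: i => [_|i IH ik]; first by exists x0; rewrite addn0.
  have [|x xi] := IH; first exact: ltnW.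
  have xv : x != v0 by rewrite -(dist_eq0 v0 e_conn); apply/eqP => x0'; move: xi ik;
    rewrite x0'; lia.
  by exists (par x); rewrite (dist_tree_parent tree_e) //; lia.
by have [|x xm] := H (k - m.+1); [lia|exists x; lia].
Qed.

(** Level [k - j + 1] is distance [k - j], written additively to avoid truncated subtraction. The
    common degree makes the vertex picked by [Bd] immaterial. *)
Lemma BdE j x : 0 < j <= k -> dist x + j = k -> Bd e v0 k j = deg e x.
Proof.
move=> jk xj; rewrite /Bd; case: pickP => [y /eqP yl|/(_ x)].
  have [_ _ _ degE] := bethe_e; apply: degE; rewrite yl /level; congr _.+1; lia.
by rewrite /level => /eqP[]; congr _.+1; lia.
Qed.

Lemma nchildren_Bd j x : 0 < j <= k -> dist x + j = k ->
  nchildren e v0 x = Bd e v0 k j - (j != k).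
Proof.
move=> jk xj; rewrite (BdE jk xj) (deg_tree v0 tree_e) -(dist_eq0 v0 e_conn).
have -> : (dist x != 0) = (j != k) by lia.
by rewrite addKn.
Qed.

(** Some vertex lies one level further down, so its parent has a child; vertices of one level have
    equally many children. *)
Lemma nchildren_gt0 x : (dist x).+1 < k -> 0 < nchildren e v0 x.
Proof.
move=> xk; have [y yx] := exists_dist xk.
have yv : y != v0 by rewrite -(dist_eq0 v0 e_conn) yx.
have := dist_tree_parent tree_e yv; rewrite yx => -[pyx].
rewrite (@nchildren_Bd (k - dist x)) -?(@nchildren_Bd (k - dist x) (par y)); try lia.
by apply/card_gt0P; exists y; rewrite inE yv eqxx.
Qed.

Lemma nchildren_leaf x : (dist x).+1 = k -> nchildren e v0 x = 0.
Proof.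
move=> xk; apply/eqP; rewrite cards_eq0; apply/eqP/setP => y; rewrite !inE.
apply/negP => /andP[/(dist_tree_parent tree_e) + /eqP yx]; rewrite yx xk => yk.
by have := dist_lt_levels y; rewrite -yk ltnn.
Qed.

Lemma Bn_top : 0 < k -> Bn e v0 k k = 1.
Proof.
move=> k0; rewrite /Bn -(cards1 v0); apply: eq_card => x.
by rewrite !inE subnn /level eqSS dist_eq0.
Qed.

(** No vertex above the leaves is childless, so [par] maps the level counted by [n_j] onto the one
    counted by [n_(j+1)]. *)
Lemma Bn_decr j : 0 < j < k -> Bn e v0 k j.+1 <= Bn e v0 k j.
Proof.
move=> jk; rewrite /Bn.
set A := [set x | _]; set B := [set x | _].
have sub : A \subset par @: B.
  apply/subsetP => x; rewrite inE /level eqSS => /eqP xd.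
  have : 0 < nchildren e v0 x by apply: nchildren_gt0; lia.
  case/card_gt0P => y; rewrite inE => /andP[yv /eqP yx].
  apply/imsetP; exists y => //; rewrite inE /level -(dist_tree_parent tree_e) // yx xd.
  by apply/eqP; lia.
exact: leq_trans (subset_leq_card sub) (leq_imset_card _ _).
Qed.

End Bethe.

(** * Real symmetric matrices *)

Section RealSymmetric.
Context {R : rcfType} {n : nat} (A : 'M[R]_n).
Hypothesis A_sym : A^T = A.
Local Notation toC := (map_mx (real_complex R)).
Local Open Scope sesquilinear_scope.

(** Diagonalization takes place over [R[i]]. The spectrum of a hermitian matrix being real, the
    diagonal comes back to [R], while [P] may stay complex. *)
Lemma real_spectral : exists (P : 'M[R[i]]_n) (s : 'rV[R]_n),
  [/\ P \is unitarymx, toC A = P^t* *m diag_mx (toC s) *m P &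
      forall i, eigenvalue A (s 0 i)].
Proof.
have AC_herm : toC A \is hermsymmx.
  apply: realsym_hermsym; last first.
    by apply/mxOverP => i j; rewrite mxE; apply/complex_realP; exists (A i j).
  by apply/is_hermitianmxP; rewrite expr0 scale1r map_mx_id // map_trmx A_sym.
have PU := spectral_unitarymx (toC A).
have /orthomx_spectralP AE := hermitian_normalmx AC_herm.
have /mxOverP sR := hermitian_spectral_diag_real AC_herm.
move: PU AE sR; set P := spectralmx _; set s := spectral_diag _ => PU AE sR.
pose t : 'rV[R]_n := map_mx (@complex.Re R) s.
have tE : toC t = s by apply/rowP => i; rewrite !mxE RRe_real // ord1.
exists P, t; rewrite tE -invmx_unitary //; split=> // i.
have : eigenvalue (toC A) (t 0 i)%:C%C.
  apply/eigenvalueP; exists (row i P).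
    rewrite -row_mul AE !mulmxA mulmxV ?unitarymx_unit // mul1mx row_mul.
    have -> : row i (diag_mx s) = (t 0 i)%:C%C *: delta_mx 0 i.
      apply/rowP => j; rewrite -tE !mxE eqxx /=.
      by rewrite [j == i]eq_sym; case: eqP => [->|_]; rewrite ?mulr1 ?mulr0.
    by rewrite -scalemxAl -rowE.
  apply/eqP => P0; have := unitarymxP PU => /matrixP /(_ i i).
  rewrite !mxE eqxx => /eqP; rewrite big1 ?(eq_sym 0) ?oner_eq0 // => j _.
  by move/rowP/(_ j): P0; rewrite !mxE => ->; rewrite mul0r.
by rewrite !eigenvalue_root_char -map_char_poly fmorph_root.
Qed.

(** In the coordinates [w] both quadratic forms are sums of [|w_i|^2], with weights [s_i] and 1. *)
Lemma rayleigh_le (lam : R) (v : 'rV[R]_n) :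
  (forall mu, eigenvalue A mu -> mu <= lam) ->
  (v *m A *m v^T) 0 0 <= lam * (v *m v^T) 0 0.
Proof.
move=> lamP; have [P [s [PU AE sP]]] := real_spectral.
pose w := toC v *m P^t*.
have vC : (toC v)^t* = toC v^T.
  by apply/matrixP => i j; rewrite !mxE; apply: conjc_real.
have wC : w^t* = P *m toC v^T.
  by rewrite /w trmx_mul map_mxM /= trmxCK vC.
have E1 : ((v *m A *m v^T) 0 0)%:C%C = \sum_i (s 0 i)%:C%C * (w 0 i * (w 0 i)^*).
  transitivity ((w *m diag_mx (toC s) *m w^t*) 0 0).
    by rewrite wC /w !mulmxA -(mulmxA (toC v)) -(mulmxA (toC v)) -AE -!map_mxM [RHS]mxE.
  by rewrite mul_mx_diag mxE; apply: eq_bigr => i _; rewrite !mxE mulrAC mulrC.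
have E2 : ((v *m v^T) 0 0)%:C%C = \sum_i (w 0 i * (w 0 i)^*).
  transitivity ((w *m w^t*) 0 0); last by rewrite mxE; apply: eq_bigr => i _; rewrite !mxE.
  by rewrite wC /w mulmxA mulmxKtV // -map_mxM [RHS]mxE.
rewrite -lecR rmorphM /= E1 E2 mulr_sumr; apply: ler_sum => i _.
by apply: ler_wpM2r; rewrite ?mul_conjC_ge0 // lecR lamP.
Qed.

Lemma exists_largest_eigenvalue : (0 < n)%N -> exists lam, is_largest_eigenvalue A lam.
Proof.
move=> n0; have [P [s [PU AE sP]]] := real_spectral.
(* An eigenvector has a nonzero coordinate [w 0 i]; comparing both sides there gives
   [mu = s 0 i]. *)
have sall mu : eigenvalue A mu -> exists i, mu = s 0 i.
  rewrite eigenvalue_root_char -(fmorph_root (real_complex R)) map_char_poly -eigenvalue_root_char.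
  case/eigenvalueP => v vA vN0; pose w := v *m P^t*.
  have wN0 : w != 0.
    apply: contra vN0 => /eqP w0; by rewrite -(mulmxKtV v PU) // -/w w0 mul0mx.
  have wE : w *m diag_mx (toC s) = mu%:C%C *: w.
    have := congr1 (mulmxr (P^t* )) vA; rewrite /= AE !mulmxA -scalemxAl.
    by rewrite mulmxtVK.
  have [i wi] : exists i, w 0 i != 0.
    by apply/existsP; apply: contraR wN0 => /existsPn w0; apply/eqP/rowP => i;
       rewrite [RHS]mxE; apply/eqP; have := w0 i; rewrite negbK.
  exists i; move/rowP/(_ i): wE; rewrite mul_mx_diag [LHS]mxE [RHS]mxE [X in _ * X]mxE mulrC.
  by move=> sw; apply/esym/complexI/(mulIf wi).
have [j _ jmax] := arg_maxP (fun i => s 0 i) (isT : xpredT (Ordinal n0)).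
exists (s 0 j); split=> // mu /sall[i ->]; exact: jmax.
Qed.
End RealSymmetric.

(** * Jacobi matrices *)

Lemma horner_char_poly {F : comNzRingType} {n} (A : 'M[F]_n) x :
  (char_poly A).[x] = \det (x%:M - A).
Proof.
rewrite -[LHS]/(horner_eval x _) -det_map_mx; congr (\det _); apply/matrixP => i j.
by rewrite !mxE /= horner_evalE hornerD hornerN hornerC hornerMn hornerX.
Qed.

(** [(p - q) * m] vanishes everywhere, and the natural numbers supply more roots than its degree
    allows. *)
Lemma poly_eq_off_roots {F : numDomainType} (m p q : {poly F}) :
  m != 0 -> (forall x, m.[x] != 0 -> p.[x] = q.[x]) -> p = q.
Proof.
move=> mN0 pq; apply/eqP; rewrite -subr_eq0.
suff: (p - q) * m == 0 by rewrite mulf_eq0 (negbTE mN0) orbF.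
apply: contraT => sN0; set s := _ * m in sN0.
pose rs : seq F := [seq i%:R | i <- iota 0 (size s)].
have rsroot : all (root s) rs.
  apply/allP => x _; rewrite rootE hornerM hornerD hornerN.
  by have [->|/pq ->] := eqVneq m.[x] 0; rewrite ?mulr0 // subrr mul0r.
have rsuniq : uniq rs by rewrite map_inj_uniq ?iota_uniq //; apply: mulrIn; rewrite oner_eq0.
by have := max_poly_roots sN0 rsroot rsuniq; rewrite size_map size_iota ltnn.
Qed.

Section Jacobi.
Context {F : fieldType}.

(** Pivots of Gaussian elimination on the symmetric tridiagonal matrix with diagonal [a] and
    off-diagonal [-b]. Division by a zero pivot returns 0, so [det_jacobi] asks all pivots but the
    last to be nonzero. *)
Fixpoint pivot (a b : nat -> F) n :=
  if n is m.+1 then a n - b m ^+ 2 / pivot a b m else a 0%N.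

Lemma eq_pivot a a' b n : (forall i, (i <= n)%N -> a i = a' i) ->
  pivot a b n = pivot a' b n.
Proof.
elim: n => [|n IH] aE /=; first exact: aE.
by rewrite aE // IH // => i ilen; apply: aE; apply: ltnW.
Qed.

Lemma pivot_shift_last a a' b n c :
  (forall i, (i < n)%N -> a i = a' i) -> a n = a' n - c ->
  pivot a b n = pivot a' b n - c.
Proof.
case: n => [|n] //= aE ->; rewrite (@eq_pivot a a') => [|i]; last exact: aE.
by rewrite addrAC.
Qed.

(** A path is a tree rooted at its last vertex, with [i + 1] the parent of [i], so [det_forest]
    applies with a diagonal [D]. *)
Lemma det_jacobi (a b : nat -> F) n (M : 'M[F]_n.+1) :
  (forall i j : 'I_n.+1, M i j = if i == j :> nat then a i
     else if j == i.+1 :> nat then - b i else if i == j.+1 :> nat then - b j else 0) ->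
  (forall i, (i < n)%N -> pivot a b i != 0) ->
  \det M = \prod_(i < n.+1) pivot a b i.
Proof.
move=> ME pN0.
have -> : M = \matrix_(i, j) M (id i) (id j) by apply/matrixP => i j; rewrite mxE.
have rtE (i : 'I_n.+1) : (i != ord_max) = (i < n)%N.
  by rewrite -val_eqE /= ltn_neqAle -ltnS ltn_ord andbT.
have parE (i : 'I_n.+1) : i != ord_max -> (inord i.+1 : 'I_n.+1) = i.+1 :> nat.
  by rewrite rtE => lt; rewrite inordK.
rewrite (@det_forest _ _ _ id (fun i => i == ord_max) (fun i => inord i.+1)
  (fun i => n - i)%N (fun i => b i) (fun i => pivot a b i)
  (fun i j => if i == j then pivot a b i else 0)).
- rewrite (_ : \matrix_(i, j) _ = diag_mx (\row_i pivot a b i)).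
    by rewrite det_diag; apply: eq_bigr => i _; rewrite mxE.
  by apply/matrixP => i j; rewrite !mxE; case: eqP => [->|].
- by exists id.
- by move=> i iN; rewrite parE //; move: iN; rewrite rtE; lia.
- by move=> i; rewrite rtE; exact: pN0.
- by [].
move=> i j; rewrite ME.
have pE (u v : 'I_n.+1) : (u != ord_max) && (inord u.+1 == v) = (v == u.+1 :> nat).
  have [->|uN] /= := eqVneq u ord_max; first by apply/esym/eqP => vn; have := ltn_ord v;
    rewrite vn ltnn.
  by rewrite -val_eqE /= parE // eq_sym.
rewrite !pE -val_eqE /=; case: (altP (i =P j :> nat)) => [ij|ij]; last first.
  rewrite sub0r addr0; case: ifP => [/eqP ji|_]; last by case: ifP => _;
    rewrite ?oppr0 ?sub0r ?addr0.
  by rewrite ifF ?subr0 //; apply/eqP; lia.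
rewrite ij !ifF ?subr0; try by apply/eqP; lia.
under eq_bigl => c do rewrite pE ij.
(* Index 0 has no child; [m + 1] has the single child [m], whose correction is the term subtracted
   in [pivot]. *)
case: (j) => -[|m] /= jn; first by rewrite big1 ?addr0 // => c /eqP.
rewrite (bigD1 (Ordinal (ltnW jn))) //= big1 ?addr0 ?subrK // => c /andP[/eqP[cm]].
by rewrite -val_eqE /= cm eqxx.
Qed.
End Jacobi.

(** Summation by parts in the exponents: [g i] occurs in every prefix product longer than [i]. This
    turns powers of pivots into powers of leading principal minors. *)
Lemma prod_exp_telescope {F : comNzRingType} (g : nat -> F) (a : nat -> nat) m :
  (forall j, (0 < j <= m)%N -> (a j.+1 <= a j)%N) ->
  \prod_(1 <= j < m.+1) g j.-1 ^+ a j =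
  \prod_(1 <= j < m.+1) (\prod_(i < j) g i) ^+ (a j - a j.+1)
    * (\prod_(i < m) g i) ^+ a m.+1.
Proof.
elim: m => [|m IH] adec; first by rewrite !big_nil big_ord0 expr1n mulr1.
rewrite big_nat_recr //= IH => [|j /andP[j0 jm]]; last by apply: adec; rewrite j0 ltnW.
rewrite [in RHS]big_nat_recr //= -!mulrA; congr (_ * _).
by rewrite -exprD subnK ?adec ?leqnn // big_ord_recr /= exprMn.
Qed.

(** * Characteristic polynomial of the rooted product *)

Section TentryPivots.
Context {R : rcfType} (alpha : R) (d : nat -> nat) (k : nat).

(** Pivots of [x I - T_k]; the [T_j] share them, being leading submatrices. *)
Definition Tpivot (x : R) : nat -> R :=
  pivot (fun i => x - Tentry alpha d k i i) (fun i => Tentry alpha d k i i.+1).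

Lemma TentryC i j : Tentry alpha d k i j = Tentry alpha d k j i.
Proof.
rewrite /Tentry; case: (altP (i =P j)) => [->|ij]; rewrite ?eqxx //.
by rewrite [j == i]eq_sym (negbTE ij) orbC minnC.
Qed.

Lemma Tentry_far i j : i != j -> j != i.+1 -> i != j.+1 -> Tentry alpha d k i j = 0.
Proof. by rewrite /Tentry => /negbTE -> /negbTE -> /negbTE ->. Qed.

Lemma horner_char_Tmat x j : (forall i, (i < j)%N -> Tpivot x i != 0) ->
  (char_poly (Tmat alpha d k j.+1)).[x] = \prod_(i < j.+1) Tpivot x i.
Proof.
move=> pN0; rewrite horner_char_poly; apply: det_jacobi => // u v; rewrite !mxE -val_eqE /=.
case: (altP (u =P v :> nat)) => [->|uv] //; rewrite sub0r.
case: (altP (v =P u.+1 :> nat)) => [->|uv1] //.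
case: (altP (u =P v.+1 :> nat)) => [->|uv2] //; first by rewrite TentryC.
by rewrite Tentry_far ?oppr0.
Qed.

Lemma Tpivot_neq0 x m :
  (forall j, (0 < j <= m)%N -> (char_poly (Tmat alpha d k j)).[x] != 0) ->
  forall i, (i < m)%N -> Tpivot x i != 0.
Proof.
move=> cN0 i; elim/ltn_ind: i => i IH im.
have := cN0 i.+1; rewrite horner_char_Tmat => [|j ji]; last by apply: IH => //; apply: ltn_trans im.
by move=> /(_ im); rewrite big_ord_recr /= mulf_eq0 negb_or => /andP[].
Qed.

End TentryPivots.

(** [rho] touches only the last diagonal entry, hence only the last pivot. *)
Lemma horner_char_Smat (R : rcfType) (alpha : R) d k rho x :
  (forall i, (i < k)%N -> Tpivot alpha d k.+1 x i != 0) ->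
  (char_poly (Smat alpha d k.+1 rho)).[x] =
  \prod_(i < k) Tpivot alpha d k.+1 x i * (Tpivot alpha d k.+1 x k - rho).
Proof.
move=> pN0; rewrite horner_char_poly.
pose a i := x - Tentry alpha d k.+1 i i - (if i == k then rho else 0).
pose b i := Tentry alpha d k.+1 i i.+1.
have aE i : (i < k)%N -> a i = x - Tentry alpha d k.+1 i i.
  by rewrite /a => ik; rewrite ltn_eqF // subr0.
have pE i : (i < k)%N -> pivot a b i = Tpivot alpha d k.+1 x i.
  by move=> ik; apply: eq_pivot => j ji; apply/aE/(leq_ltn_trans ji).
rewrite (@det_jacobi _ a b) => [|u v|i ik]; last by rewrite pE ?pN0.
  rewrite big_ord_recr /=; congr (_ * _); first by apply: eq_bigr => i _; rewrite pE.
  by apply: pivot_shift_last => //; rewrite /a eqxx.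
rewrite !mxE -val_eqE /=.
case: (altP (u =P v :> nat)) => [->|uv].
  by rewrite andbb /a opprD addrA; case: ifP; rewrite ?subr0.
rewrite sub0r ifF ?addr0; last by apply/negP => /andP[/eqP uk /eqP vk]; rewrite uk vk eqxx in uv.
case: (altP (v =P u.+1 :> nat)) => [->|uv1] //.
case: (altP (u =P v.+1 :> nat)) => [->|uv2] //; first by rewrite TentryC.
by rewrite Tentry_far ?oppr0.
Qed.

(** Irreflexivity of [eH] keeps the neighbours of a root inside its copy apart from those along
    [eR], which are all roots. *)
Lemma deg_rooted_prod r (eR : rel 'I_r) (T : finType) (eH : rel T) v0 i x :
  irreflexive eH ->
  deg (rooted_prod eR eH v0) (i, x) = (deg eH x + (if x == v0 then deg eR i else 0))%N.
Proof.
move=> irr; rewrite /deg.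
pose X := [set (i, y) | y in [set y | eH x y]].
pose Y := if x == v0 then [set (j, v0) | j in [set j | eR i j]] else set0.
have -> : [set u | rooted_prod eR eH v0 (i, x) u] = X :|: Y.
  apply/setP => -[j y]; rewrite !inE /rooted_prod /=; congr (_ || _).
    apply/andP/imsetP => [[/eqP -> xy]|[z]]; first by exists y; rewrite ?inE.
    by rewrite inE => xz [-> ->].
  rewrite /Y; case: eqP => _ /=; last by rewrite inE.
  apply/andP/imsetP => [[/eqP -> ij]|[z]]; first by exists j; rewrite ?inE.
  by rewrite inE => xz [-> ->].
have XY : [disjoint X & Y].
  apply/pred0P => -[j y] /=; apply/negP => /andP[/imsetP[z + [-> ->]]].
  rewrite inE /Y; case: eqP => [->|_]; last by rewrite inE.
  by move=> vz /imsetP[t _ [_ zv]]; rewrite zv irr in vz.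
have := (leq_card_setU X Y).2; rewrite XY => /eqP ->; congr (_ + _)%N.
  by rewrite card_imset // => ? ? [].
by rewrite /Y; case: eqP => _; rewrite ?cards0 // card_imset // => ? ? [].
Qed.

Section RootedBethe.
Context {R : rcfType} {r : nat} (eR : rel 'I_r) {T : finType} (eH : rel T) (v0 : T) (k : nat)
  (alpha : R).
Hypotheses (eR_simple : simple_graph eR) (bethe : gen_Bethe_tree eH v0 k) (k_ge2 : (2 <= k)%N).
Let d := Bd eH v0 k.
Let n := Bn eH v0 k.
Let A := Aalpha (rooted_prod eR eH v0) alpha.
Local Notation dist := (dist eH v0).
Local Notation par := (tree_parent eH v0).
Local Notation p := (Tpivot alpha d k).
Local Notation beta := (1 - alpha).

Let tree_eH : is_tree eH. Proof. by case: bethe. Qed.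
Let eH_irr : irreflexive eH. Proof. by case: tree_eH => [[]]. Qed.
Let eH_conn : connected_graph eH. Proof. by case: tree_eH => [_ []]. Qed.
Let eR_irr : irreflexive eR. Proof. by case: eR_simple. Qed.

(** Elimination on the tree and on the path obey the same recursion: [beta ^+ 2] times the number of
    children is a squared off-diagonal entry of [T_k]. At a leaf the second index truncates to 0,
    harmlessly since its coefficient is 0. *)
Lemma Tpivot_Bethe (z : R) (x : T) :
  p z (k.-1 - dist x)%N + (nchildren eH v0 x)%:R * (beta ^+ 2 / p z (k.-1 - (dist x).+1)%N)
  = z - alpha * (deg eH x)%:R.
Proof.
have xk := dist_lt_levels bethe x.
case: (posnP (k.-1 - dist x)%N) => [x0|xgt0].
  have xk' : (dist x).+1 = k by lia.
  rewrite x0 (nchildren_leaf bethe) // mul0r addr0 /p /= /Tentry /= (deg_tree v0 tree_eH).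
  rewrite (nchildren_leaf bethe) // addn0 -(dist_eq0 v0 eH_conn).
  have -> : (dist x != 0%N) by lia.
  by rewrite mulr1.
have [m mE] : exists m, (k.-1 - dist x = m.+1)%N by exists (k.-1 - dist x).-1%N; lia.
have -> : (k.-1 - (dist x).+1 = m)%N by lia.
have chE := @nchildren_Bd _ _ _ _ bethe m.+2 x.
have degE := @BdE _ _ _ _ bethe m.+2 x.
rewrite mE /p /= -/(p z m).
have -> : Tentry alpha d k m.+1 m.+1 = alpha * (deg eH x)%:R.
  by rewrite /Tentry eqxx /= /d degE //; lia.
have -> : Tentry alpha d k m m.+1 ^+ 2 = beta ^+ 2 * (nchildren eH v0 x)%:R.
  rewrite /Tentry ifF; last by apply/eqP; lia.
  rewrite eqxx /= (minn_idPl (leqnSn m)) chE; try lia.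
  have d0 : (0 < Bd eH v0 k m.+2)%N.
    have := nchildren_gt0 bethe (x := x); rewrite chE; lia.
  (* At the root all [d k] neighbours are children; elsewhere one is the parent, and [d0] makes the
     radicand [d - 1] nonnegative. *)
  case: (altP (m.+1 =P k.-1)) => [mk|mk]; rewrite exprMn sqr_sqrtr /d ?ler0n //.
  - have -> : (m.+2 != k) = false by lia.
    by rewrite subn0; congr (_ * _%:R); congr Bd; lia.
  - have -> : (m.+2 != k) by lia.
    by rewrite natrB.
  - by rewrite subr_ge0 ler1n.
by rewrite -mulrA [_%:R * _]mulrCA [_%:R / _]mulrC mulrA; ring.
Qed.

Lemma prod_levels (g : nat -> R) :
  \prod_(x | x != v0) g (k.-1 - dist x)%N = \prod_(1 <= j < k) g j.-1 ^+ n j.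
Proof.
transitivity (\prod_(1 <= j < k) \prod_x (if dist x == (k - j)%N then g j.-1 else 1)); last first.
  apply: eq_bigr => j _; rewrite -big_mkcond /= prodr_const; congr (_ ^+ _).
  by rewrite /n /Bn -sum1_card -sum1_card; apply: eq_bigl => x; rewrite !inE.
rewrite exchange_big /= big_mkcond /=; apply: eq_bigr => x _.
have xk := dist_lt_levels bethe x; rewrite -(dist_eq0 v0 eH_conn).
case: eqP => [x0|x0] /=.
  by rewrite big_nat_cond big1 // => j /andP[jk _]; rewrite ifF //; apply/eqP; lia.
rewrite (bigD1_seq (k - dist x)%N) ?mem_index_iota ?iota_uniq //=; last lia.
rewrite big_nat_cond big1 ?mulr1; first by rewrite ifT; [congr g|apply/eqP]; lia.
by move=> j jk; rewrite ifF //; apply/eqP; lia.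
Qed.

(** [det_forest] eliminates all vertices but the [r] roots. By [Tpivot_Bethe] the diagonal left at a
    root is the root pivot minus [alpha] times its degree in [eR]. *)
Lemma horner_char_rooted (z : R) : (forall i, (i < k.-1)%N -> p z i != 0) ->
  (char_poly A).[z] = \prod_(1 <= j < k) p z j.-1 ^+ (r * n j)
                      * (char_poly (Aalpha eR alpha)).[p z k.-1].
Proof.
move=> pN0; rewrite !horner_char_poly.
pose M (u v : 'I_r * T) := (if u == v then z - alpha * (deg (rooted_prod eR eH v0) u)%:R else 0)
   - beta * (rooted_prod eR eH v0 u v)%:R.
pose K : 'M[R]_r := \matrix_(i, j) ((if i == j then p z k.-1 - alpha * (deg eR i)%:R else 0)
   - beta * (eR i j)%:R).
pose f (u : 'I_r * T) := p z (k.-1 - dist u.2)%N.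
pose D (u v : 'I_r * T) := if (u.2 == v0) && (v.2 == v0) then K u.1 v.1
   else if u == v then f u else 0.
have -> : z%:M - A = \matrix_(i, j) M (enum_val i) (enum_val j).
  apply/matrixP => i j; rewrite !mxE /M (inj_eq enum_val_inj) opprD addrA; congr (_ - _).
  by case: eqP; rewrite ?subr0.
have -> : (p z k.-1)%:M - Aalpha eR alpha
    = \matrix_(i, j) K (enum_val i) (enum_val j).
  apply/matrixP => i j; rewrite !mxE (inj_eq enum_val_inj) opprD addrA; congr (_ - _).
  by case: eqP; rewrite ?subr0.
(* [Aalpha eR] is indexed by [#|'I_r|]; [det_root_block] with a one-point tree transports its
   determinant to ['I_r]. *)
have -> : \det (\matrix_(i, j < #|'I_r|) K (enum_val i) (enum_val j)) = \det K.
  rewrite (@det_root_block _ _ r unit (fun i => (enum_val i, tt)) tt (fun=> 0) K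
     (fun u v => K u.1 v.1)).
  - by rewrite big1 ?mul1r // => -[? []].
  - exists (fun u => enum_rank u.1) => [i|[i []]] /=; first exact: enum_valK.
    by rewrite enum_rankK.
  - by move=> [? []] [? []].
have bij : bijective (@enum_val ('I_r * T)%type predT).
  by exists enum_rank; [exact: enum_valK|exact: enum_rankK].
rewrite (@det_forest _ _ _ _ (fun u => u.2 == v0) (fun u => (u.1, par u.2))
   (fun u => dist u.2) (fun=> beta) f D) //.
- rewrite (@det_root_block _ _ _ _ _ v0 f K) //; congr (_ * _).
  transitivity (\prod_(i < r) \prod_(x | x != v0) p z (k.-1 - dist x)%N).
    by rewrite pair_big_dep; apply: eq_bigl => -[i x].
  rewrite prodr_const card_ord prod_levels -prodrXl.
  by apply: eq_bigr => j _; rewrite -exprM mulnC.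
- by move=> [i x] /= xv; rewrite (dist_tree_parent tree_eH).
- move=> [i x] /= xv; apply: pN0 => /=; move: xv; rewrite -(dist_eq0 v0 eH_conn); lia.
- by move=> u v /negbTE uv; rewrite /D uv.
move=> [i x] [j y]; rewrite /M /D /rooted_prod /=.
have -> : \sum_(c | ~~ (c.2 == v0) && ((c.1, par c.2) == (i, x))) beta ^+ 2 / f c
    = (nchildren eH v0 x)%:R * (beta ^+ 2 / p z (k.-1 - (dist x).+1)%N).
  transitivity (\sum_(c | c \in [set (i, y) | y in [set y | (y != v0) && (par y == x)]])
     beta ^+ 2 / p z (k.-1 - (dist x).+1)%N).
    have E : (fun c : 'I_r * T => ~~ (c.2 == v0) && ((c.1, par c.2) == (i, x))) =1
      (fun c => c \in [set (i, y) | y in [set y | (y != v0) && (par y == x)]]).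
      case=> a t /=; rewrite xpair_eqE.
      apply/idP/imsetP => [/and3P[tv /eqP-> tx]|[t']]; first by exists t; rewrite // inE tv.
      by rewrite inE => /andP[tv tx] [-> ->]; rewrite eqxx tv.
    rewrite -(eq_bigl _ _ E); apply: eq_bigr => -[a t] /=; rewrite xpair_eqE.
    case/and3P=> tv _ /eqP <-; rewrite /f /= (dist_tree_parent tree_eH) //.
  by rewrite sumr_const card_imset 1?mulr_natl // => ? ? [].
rewrite deg_rooted_prod // (tree_edgeE v0 tree_eH) !xpair_eqE.
have piv := Tpivot_Bethe z x; rewrite /f /=.
have parN t : t != v0 -> (par t == t) = false.
  by move=> /(dist_tree_parent tree_eH) tE; apply/eqP => e; move: tE; rewrite e; lia.
case: (eqVneq x v0) piv => [->|xv] /=; case: (eqVneq y v0) => [->|yv] piv /=;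
  rewrite ?eqxx ?andbF ?andbT ?orbF /=.
- rewrite mxE; have [->|ij] := eqVneq i j; last by ring.
  rewrite eR_irr natrD mulrDr opprD addrA -piv (dist0 v0 eH_conn) subn0; ring.
- rewrite [j == i]eq_sym; case: (i == j) => /=; last by ring.
  by case: (par y == v0) => /=; ring.
- rewrite (negbTE xv) ?andbF; case: (i == j) => /=; last by ring.
  by case: (par x == v0) => /=; ring.
- have [_|_] /= := eqVneq i j; last by ring.
  have [xy|xy] := eqVneq x y.
    by rewrite -xy parN // addn0 -piv /=; ring.
  have [/eqP e|_] := boolP (par x == y); have [/eqP e'|_] := boolP (par y == x) => /=; try by ring.
  by have := dist_tree_parent tree_eH xv; have := dist_tree_parent tree_eH yv; rewrite e e'; lia.
Qed.

Lemma char_poly_rooted (rho : 'I_r -> R) :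
  char_poly (Aalpha eR alpha) = \prod_(i < r) ('X - (rho i)%:P) ->
  char_poly A = \prod_(1 <= j < k) char_poly (Tmat alpha d k j) ^+ (r * (n j - n j.+1))
                * \prod_(i < r) char_poly (Smat alpha d k (rho i)).
Proof.
(* Off the zeros of [m] no pivot before the last one vanishes. *)
move=> rhoE; pose m := \prod_(1 <= j < k) char_poly (Tmat alpha d k j).
apply: (@poly_eq_off_roots _ m).
  by apply/monic_neq0/monic_prod => j _; apply: char_poly_monic.
move=> z; rewrite horner_prod => mz.
have cz j : (0 < j <= k.-1)%N -> (char_poly (Tmat alpha d k j)).[z] != 0.
  move=> jk; apply: contra mz => /eqP c0.
  by rewrite (bigD1_seq j) ?mem_index_iota ?iota_uniq //= ?c0 ?mul0r //; lia.
have pN0 := Tpivot_neq0 cz.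
rewrite horner_char_rooted // hornerM !horner_prod rhoE horner_prod.
have [k' kE] : exists k', k = k'.+1 by exists k.-1; lia.
have nmono j : (0 < j <= k.-1)%N -> (r * n j.+1 <= r * n j)%N.
  by move=> jk; rewrite leq_mul2l (Bn_decr bethe) ?orbT //; lia.
have := prod_exp_telescope (p z) nmono.
rewrite (ltn_predK k_ge2) => ->; rewrite -mulrA; congr (_ * _).
  apply: eq_big_nat => j jk; rewrite horner_exp mulnBr; congr (_ ^+ _).
  case: j jk => // j jk; rewrite horner_char_Tmat // => i ij; apply: pN0; lia.
(* As [n_k = 1], the leftover prefix product has exponent [r]: one copy goes to each [S_i]. *)
rewrite /n (Bn_top bethe); last lia.
rewrite muln1 -[in X in _ ^+ X](card_ord r) -prodr_const -big_split /=.
apply: eq_bigr => i _; rewrite hornerXsubC.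
rewrite /d; move: pN0; rewrite /d; move: (Bd eH v0 k) => d'; rewrite kE /= => pN0.
by rewrite horner_char_Smat.
Qed.

End RootedBethe.

(** * Largest eigenvalues *)

Lemma mup_prod {F : fieldType} (I : eqType) (s : seq I) (p : I -> {poly F}) x :
  (forall i, p i != 0) -> mup x (\prod_(i <- s) p i) = (\sum_(i <- s) mup x (p i))%N.
Proof.
move=> pN0; elim: s => [|i s IH]; first by rewrite !big_nil mupNroot // root1.
by rewrite !big_cons mupM ?IH // prodf_seq_neq0; apply/allP => j _; apply: pN0.
Qed.

Lemma mup_exp {F : fieldType} (p : {poly F}) n x :
  p != 0 -> mup x (p ^+ n) = (n * mup x p)%N.
Proof.
move=> pN0; elim: n => [|n IH]; first by rewrite mupNroot // root1.
by rewrite exprS mupM ?expf_neq0 // IH mulSn.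
Qed.

Lemma eigenvalue_eig_mult {F : fieldType} n (A : 'M[F]_n) x :
  eigenvalue A x = (0 < eig_mult A x)%N.
Proof.
have cN0 := monic_neq0 (char_poly_monic A).
by rewrite eigenvalue_root_char /eig_mult mup_geq // expr1 dvdp_XsubCl.
Qed.

Section Rayleigh.
Context {R : rcfType}.

Lemma sqnorm_gt0 n (v : 'rV[R]_n) : v != 0 -> 0 < (v *m v^T) 0 0.
Proof.
move=> vN0; rewrite lt_neqAle eq_sym mxE.
have ge i : true -> 0 <= v 0 i * v^T i 0 by move=> _; rewrite mxE -expr2 sqr_ge0.
rewrite sumr_ge0 // andbT psumr_eq0 //; apply: contra vN0 => /allP v0.
apply/eqP/rowP => i; have := v0 i (mem_index_enum _); rewrite !mxE /= mulf_eq0 orbb.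
by move/eqP.
Qed.

(** For an eigenvector [v] of [B], [mu |v|^2 = v B v^T] is at most the form of [A] at [v J], hence
    at most [lam |v J|^2 = lam |v|^2]. *)
Lemma eigenvalue_le_compression m n (A : 'M[R]_n) (B : 'M[R]_m) (J : 'M[R]_(m, n)) lam mu :
  A^T = A -> (forall x, eigenvalue A x -> x <= lam) ->
  J *m J^T = 1%:M ->
  (forall v : 'rV_m, (v *m B *m v^T) 0 0 <= (v *m (J *m A *m J^T) *m v^T) 0 0) ->
  eigenvalue B mu -> mu <= lam.
Proof.
move=> Asym lamP JJ le /eigenvalueP[v vB vN0].
rewrite -(ler_pM2r (sqnorm_gt0 vN0)).
have := rayleigh_le Asym (v *m J) lamP; rewrite trmx_mul !mulmxA.
rewrite -[in X in _ <= X](mulmxA v J) JJ mulmx1; apply: le_trans.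
by have := le v; rewrite vB -scalemxAl mxE !mulmxA.
Qed.

(** With [w] the entrywise absolute value of an eigenvector [v], [|mu| |v|^2 = |v A v^T| <= w A w^T
    <= lam |v|^2]. *)
Lemma norm_eigenvalue_le n (A : 'M[R]_n) lam mu :
  A^T = A -> (forall i j, 0 <= A i j) -> (forall x, eigenvalue A x -> x <= lam) ->
  eigenvalue A mu -> `|mu| <= lam.
Proof.
move=> Asym A0 lamP /eigenvalueP[v vA vN0].
have v2 := sqnorm_gt0 vN0; rewrite -(ler_pM2r v2).
pose w := map_mx Num.norm v.
have ww : (w *m w^T) 0 0 = (v *m v^T) 0 0.
  by rewrite !mxE; apply: eq_bigr => i _; rewrite !mxE -normrM -expr2 ger0_norm ?sqr_ge0.
have := rayleigh_le Asym w lamP; rewrite ww; apply: le_trans.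
have -> : `|mu| * (v *m v^T) 0 0 = `|(v *m A *m v^T) 0 0|.
  by rewrite vA -scalemxAl [in RHS]mxE normrM (gtr0_norm v2).
rewrite ![(_ *m _^T) 0 0]mxE; apply: le_trans (ler_norm_sum _ _ _) _.
apply: ler_sum => i _; rewrite ![_^T i 0]mxE normrM [w 0 i]mxE ler_wpM2r //.
rewrite ![(_ *m A) 0 i]mxE; apply: le_trans (ler_norm_sum _ _ _) _.
by apply: ler_sum => j _; rewrite normrM (ger0_norm (A0 _ _)) [w 0 j]mxE.
Qed.
End Rayleigh.

Lemma tr_Aalpha {R : nzRingType} {T : finType} (e : rel T) (alpha : R) :
  symmetric e -> (Aalpha e alpha)^T = Aalpha e alpha.
Proof.
move=> e_sym; apply/matrixP => i j; rewrite !mxE e_sym; congr (_ + _).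
by rewrite eq_sym; case: eqP => [->|].
Qed.

Lemma Aalpha_ge0 {R : numDomainType} {T : finType} (e : rel T) (alpha : R) i j :
  0 <= alpha -> alpha <= 1 -> 0 <= Aalpha e alpha i j.
Proof.
move=> a0 a1; rewrite mxE addr_ge0 //; last by rewrite mulr_ge0 ?subr_ge0.
by case: ifP => // _; rewrite mulr_ge0.
Qed.

Lemma rooted_prod_sym r (eR : rel 'I_r) (T : finType) (eH : rel T) v0 :
  symmetric eR -> symmetric eH -> symmetric (rooted_prod eR eH v0).
Proof.
by move=> sR sH u v; rewrite /rooted_prod sR sH eq_sym; congr (_ || _); rewrite andbCA.
Qed.

Section SmatDominates.
Context {R : rcfType} (alpha : R) (d : nat -> nat) (k : nat) (rho lam : R).
Hypothesis lamP : forall x, eigenvalue (Smat alpha d k rho) x -> x <= lam.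

Lemma tr_Smat s : (Smat alpha d k s)^T = Smat alpha d k s.
Proof. by apply/matrixP => i j; rewrite !mxE TentryC andbC. Qed.

(** Raising [s] to [rho] adds a positive semidefinite diagonal matrix. *)
Lemma eigenvalue_Smat_le s mu :
  s <= rho -> eigenvalue (Smat alpha d k s) mu -> mu <= lam.
Proof.
move=> le; apply: (eigenvalue_le_compression (J := 1%:M) (tr_Smat rho) lamP).
  by rewrite mul1mx trmx1.
move=> v; rewrite trmx1 mul1mx mulmx1 -subr_ge0.
have -> : (v *m Smat alpha d k rho *m v^T) 0 0 - (v *m Smat alpha d k s *m v^T) 0 0
   = (v *m (Smat alpha d k rho - Smat alpha d k s) *m v^T) 0 0.
  by rewrite mulmxBr mulmxBl [RHS]mxE; congr (_ + _); rewrite [RHS]mxE.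
have -> : Smat alpha d k rho - Smat alpha d k s =
    diag_mx (\row_(i < k) if i == k.-1 :> nat then rho - s else 0).
  apply/matrixP => i j; rewrite !mxE -val_eqE /= opprD addrACA subrr add0r.
  case: (altP (i =P j :> nat)) => [->|ij]; rewrite ?andbb ?mulr1n ?mulr0n.
    by case: ifP; rewrite ?subrr.
  suff -> : (i == k.-1 :> nat) && (j == k.-1 :> nat) = false by rewrite subrr.
  by apply/negP => /andP[/eqP ik /eqP jk]; rewrite ik jk eqxx in ij.
rewrite mul_mx_diag mxE sumr_ge0 // => i _; rewrite !mxE mulrAC mulr_ge0 //.
  by rewrite -expr2 sqr_ge0.
by case: ifP; rewrite ?subr_ge0.
Qed.

Lemma eigenvalue_Tmat_le j mu :
  (j < k)%N -> eigenvalue (Tmat alpha d k j) mu -> mu <= lam.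
Proof.
move=> jk; pose f : 'I_j -> 'I_k := widen_ord (ltnW jk).
have JE (A : 'M[R]_k) : rowsub f 1%:M *m A *m (rowsub f 1%:M)^T = mxsub f f A.
  rewrite mul_rowsub_mx mul1mx trmx_mxsub trmx1 -[colsub f _]/(mxsub id f _).
  by rewrite mulmx_colsub mulmx1; apply/matrixP => a b; rewrite !mxE.
apply: (eigenvalue_le_compression (J := rowsub f 1%:M) (tr_Smat rho) lamP).
  have := JE 1%:M; rewrite mulmx1 => ->; apply/matrixP => a b.
  by rewrite !mxE -!val_eqE.
move=> v; rewrite JE; have -> : mxsub f f (Smat alpha d k rho) = Tmat alpha d k j => //.
(* Since [j < k], the compression misses the last row, the only one carrying [rho]. *)
apply/matrixP => a b; rewrite !mxE /= ifF ?addr0 // ltn_eqF //.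
by apply: leq_trans (ltn_ord a) _; lia.
Qed.
End SmatDominates.

Theorem mainTheorem5 (R : rcfType)
  (r : nat) (eR : rel 'I_r)
  (T : finType) (eH : rel T) (v0 : T) (k : nat)
  (alpha : R) (rho : 'I_r -> R) (i1 : 'I_r) :
  simple_graph eR -> connected_graph eR ->
  gen_Bethe_tree eH v0 k -> (2 <= k)%N ->
  0 <= alpha -> alpha < 1 ->
  char_poly (Aalpha eR alpha) = \prod_(i < r) ('X - (rho i)%:P) ->
  is_spectral_radius (Aalpha eR alpha) (rho i1) ->
  let d := Bd eH v0 k in
  let n := Bn eH v0 k in
  let A := Aalpha (rooted_prod eR eH v0) alpha in
  (forall x : R,
     eig_mult A x =
       (\sum_(1 <= j < k) r * (n j - n j.+1) * eig_mult (Tmat alpha d k j) x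
        + \sum_(i < r) eig_mult (Smat alpha d k (rho i)) x)%N)
  /\
  (exists lam : R,
     is_largest_eigenvalue (Smat alpha d k (rho i1)) lam /\
     is_spectral_radius A lam).
Proof.
move=> eR_simple _ bethe k_ge2 alpha0 alpha1 rhoE rho_max d n A.
have cN0 m (B : 'M[R]_m) : char_poly B != 0 := monic_neq0 (char_poly_monic B).
have multE x : eig_mult A x =
    (\sum_(1 <= j < k) r * (n j - n j.+1) * eig_mult (Tmat alpha d k j) x
     + \sum_(i < r) eig_mult (Smat alpha d k (rho i)) x)%N.
  rewrite /eig_mult (char_poly_rooted eR_simple bethe k_ge2 rhoE).
  have TN0 j : char_poly (Tmat alpha d k j) ^+ (r * (n j - n j.+1)) != 0 by rewrite expf_neq0.
  rewrite mupM ?mup_prod //; try by rewrite prodf_seq_neq0; apply/allP => i _ /=.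
  by congr (_ + _)%N; apply: eq_bigr => j _; rewrite mup_exp.
split=> //.
have rho_le i : rho i <= rho i1.
  case: rho_max => _ rho_max; apply: le_trans (ler_norm _) _; apply: rho_max.
  rewrite eigenvalue_root_char rhoE -(big_map rho xpredT (fun y => 'X - y%:P)).
  by rewrite root_prod_XsubC map_f ?mem_index_enum.
have [|lam [lam_eig lam_max]] := exists_largest_eigenvalue (tr_Smat alpha d k (rho i1)).
  exact: ltnW.
exists lam; split=> //.
(* A positive multiplicity in [A] makes some summand positive, so [mu] is an eigenvalue of a [T_j]
   or an [S_i]. *)
have A_le mu : eigenvalue A mu -> mu <= lam.
  rewrite eigenvalue_eig_mult multE addn_gt0 => /orP[]; rewrite lt0n sum_nat_seq_neq0.
    case/hasP => j; rewrite mem_index_iota /= muln_eq0 negb_or.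
    move=> /andP[_ jk] /andP[_]; rewrite -lt0n -eigenvalue_eig_mult.
    exact: (eigenvalue_Tmat_le lam_max).
  case/hasP => i _ /=; rewrite -lt0n -eigenvalue_eig_mult.
  exact: (eigenvalue_Smat_le lam_max).
have A_norm mu : eigenvalue A mu -> `|mu| <= lam.
  apply: norm_eigenvalue_le => // [|i j]; last exact: Aalpha_ge0 (ltW _).
  apply/tr_Aalpha/rooted_prod_sym; first by case: eR_simple.
  by case: bethe => [[[]]].
(* The summand of [S_i1] has coefficient one, whereas those of the [T_j] may vanish. *)
have lam_A : eigenvalue A lam.
  rewrite eigenvalue_eig_mult multE (bigD1 i1) //= addn_gt0; apply/orP; right.
  by rewrite addn_gt0 -eigenvalue_eig_mult lam_eig.
split=> //; exists lam; split=> //.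
(* [A_norm] at [lam] itself gives [|lam| <= lam], so [lam] is its own modulus. *)
by apply/eqP; rewrite eq_le ler_norm A_norm.
Qed.
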